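(* Let $n\in\mathbb{N}$. The topological Abelian groups $\mathbb{Q}/\mathbb{Z}$, $\mathbb{Z}$ and $\mathbb{Z}/n\mathbb{Z}$ with the usual topologies verify $$E^{ws}_{\mathbf{TA}}(\mathbb{Q}/\mathbb{Z},\mathbb{Z})\not\cong0,\qquad E^{ws}_{\mathbf{TA}}(\mathbb{Q}/\mathbb{Z},\mathbb{Z}/n\mathbb{Z})\not\cong0.$$
   Context: The usual topologies: $\mathbb{Z}$ and $\mathbb{Z}/n\mathbb{Z}$ are discrete, and $\mathbb{Q}/\mathbb{Z}$ is the quotient of $\mathbb{Q}$ with its Euclidean topology (equivalently, a subspace of $\mathbb{R}/\mathbb{Z}$). $\mathbf{TA}$ is the category of topological Abelian groups and continuous homomorphisms. An extension of $B$ by $A$ in $\mathbf{TA}$ is a sequence $E=(B\xrightarrow{j}X\xrightarrow{p}A)$ where $p$ is a surjective open continuous homomorphism and $j$ is the kernel of $p$ in $\mathbf{TA}$ (a topological embedding with image $p^{-1}(0)$). It is a weak-split extension ($ws$-extension) if there is a continuous map $\mathbf{s}\colon A\to X$ (not necessarily a homomorphism) with $p\mathbf{s}=\mathrm{id}_A$, $\mathbf{s}(0)=0$. $E^{ws}_{\mathbf{TA}}(A,B)$ is the set of $ws$-extensions of $B$ by $A$ modulo the equivalence relation generated by the existence of a continuous homomorphism $\theta\colon X\to X'$ with $\theta j=j'$ and $p'\theta=p$; it is an Abelian group under the Baer sum $[E]+[E']=[\Delta_A^*((\nabla^B)_*(E\times E'))]$ (pushout in $\mathbf{TA}$ along $\nabla^B(b,b')=b+b'$,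 then pullback along $\Delta_A(a)=(a,a)$), with zero the class of the split extension $B\to B\times A\to A$.
   Formalization: The second claim is stated for n ≠ 1 only: for n = 1 the group Z/1Z is zero, every extension of 0 by Q/Z is an isomorphism onto Q/Z, so E^ws(Q/Z, Z/1Z) = 0 and the claim fails there. *)

(* Defs.v *)
From HB Require Import structures.
From Stdlib Require Import Relation_Operators.
From mathcomp Require Import all_boot all_order all_algebra ring_quotient.
From mathcomp Require Import all_classical reals topology normedtype.
Import numFieldNormedType.Exports.

Set Implicit Arguments.
Unset Strict Implicit.
Unset Printing Implicit Defensive.

Import Order.TTheory GRing.Theory Num.Theory.
Local Open Scope classical_set_scope.
Local Open Scope ring_scope.

Lemma continuous_sub_fun (T : topologicalType) (G : topologicalZmodType)
    (f g : T -> G) :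
  continuous f -> continuous g -> continuous (fun x => f x - g x).
Proof.
move=> cf cg x.
apply: (@continuous_comp _ _ _ (fun x => (f x, g x)) (fun x : G * G => x.1 - x.2)).
  by apply: cvg_pair; [exact: cf | exact: cg].
exact: sub_continuous.
Qed.

Lemma continuous_opp_fun (T : topologicalType) (G : topologicalZmodType)
    (f : T -> G) : continuous f -> continuous (fun x => - f x).
Proof.
move=> cf x; apply: (@continuous_comp _ _ _ f -%R); first exact: cf.
exact: opp_continuous.
Qed.

Lemma continuous_add_fun (T : topologicalType) (G : topologicalZmodType)
    (f g : T -> G) :
  continuous f -> continuous g -> continuous (fun x => f x + g x).
Proof.
move=> cf cg x.
apply: (@continuous_comp _ _ _ (fun x => (f x, g x)) (fun x : G * G => x.1 + x.2)).
  by apply: cvg_pair; [exact: cf | exact: cg].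
exact: add_continuous.
Qed.

Lemma continuous_pair (T U V : topologicalType) (f : T -> U) (g : T -> V) :
  continuous f -> continuous g -> continuous (fun x => (f x, g x)).
Proof. by move=> cf cg x; apply: cvg_pair; [exact: cf | exact: cg]. Qed.

Lemma continuous_compT (T U V : topologicalType) (f : T -> U) (g : U -> V) :
  continuous f -> continuous g -> continuous (fun x => g (f x)).
Proof.
by move=> cf cg x; apply: (@continuous_comp _ _ _ f g); [exact: cf | exact: cg].
Qed.

Lemma continuous_fst (U V : topologicalType) : continuous (fst : U * V -> U).
Proof. by move=> x; exact: cvg_fst. Qed.

Lemma continuous_snd (U V : topologicalType) : continuous (snd : U * V -> V).
Proof. by move=> x; exact: cvg_snd. Qed.

Section Product.
Variables G H : topologicalZmodType.

Definition tprod : Type := (G * H)%type.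

HB.instance Definition _ := Topological.copy tprod (G * H)%type.
HB.instance Definition _ := GRing.Zmodule.copy tprod (G * H)%type.

Lemma tprod_sub_continuous : continuous (fun x : tprod * tprod => x.1 - x.2).
Proof.
apply: (@continuous_pair _ G H (fun x : tprod * tprod => x.1.1 - x.2.1)
   (fun x => x.1.2 - x.2.2)); apply: continuous_sub_fun.
- exact: continuous_compT (@continuous_fst tprod tprod) (@continuous_fst G H).
- exact: continuous_compT (@continuous_snd tprod tprod) (@continuous_fst G H).
- exact: continuous_compT (@continuous_fst tprod tprod) (@continuous_snd G H).
- exact: continuous_compT (@continuous_snd tprod tprod) (@continuous_snd G H).
Qed.

HB.instance Definition _ :=
  PreTopologicalNmodule_isTopologicalZmodule.Build tprod tprod_sub_continuous.

End Product.

Section Subgroup.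
Variables (G : topologicalZmodType) (S : zmodClosed G).

Definition tsub : Type := {x : G | x \in S}.

HB.instance Definition _ := SubChoice.on tsub.
HB.instance Definition _ := [SubChoice_isSubZmodule of tsub by <:].
HB.instance Definition _ :=
  Topological.copy tsub (initial_topology (val : tsub -> G)).

Lemma tsub_val_continuous : continuous (val : tsub -> G).
Proof. exact: initial_continuous. Qed.

Lemma tsub_continuous (T : topologicalType) (f : T -> tsub) :
  continuous (fun x => val (f x)) -> continuous f.
Proof.
move=> /continuousP cf; apply/continuousP => _ [V oV <-].
exact: (cf _ oV).
Qed.

Lemma tsub_sub_continuous : continuous (fun x : tsub * tsub => x.1 - x.2).
Proof.
apply: tsub_continuous => /=.
have -> : (fun x : tsub * tsub => val (x.1 - x.2))
   = fun x => val x.1 - val x.2 by apply: funext => x; rewrite raddfB.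
apply: continuous_sub_fun.
- exact: continuous_compT (@continuous_fst tsub tsub) tsub_val_continuous.
- exact: continuous_compT (@continuous_snd tsub tsub) tsub_val_continuous.
Qed.

HB.instance Definition _ :=
  PreTopologicalNmodule_isTopologicalZmodule.Build tsub tsub_sub_continuous.

End Subgroup.

Section Quotient.
Variables (G : topologicalZmodType) (S : zmodClosed G).

Definition tquot : Type := {ideal_quot S}.

HB.instance Definition _ :=
  Topological.copy tquot (quotient_topology {ideal_quot S}).

Definition tpi (x : G) : tquot := (\pi_({ideal_quot S}) x)%qT.
Definition trepr (q : tquot) : G := repr (q : {ideal_quot S}).

Lemma treprK q : tpi (trepr q) = q. Proof. exact: reprK. Qed.

Lemma tpiE x y : (tpi x = tpi y) <-> (x - y \in S).
Proof.
rewrite Quotient.idealrBE.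
by split=> [h|/eqP h]; [apply/eqP; exact: h | exact: h].
Qed.

HB.instance Definition _ := GRing.isZmodule.Build tquot
  (@Quotient.addqA G S) (@Quotient.addqC G S)
  (@Quotient.add0q G S) (@Quotient.addNq G S).

Lemma tpi_is_zmod_morphism : zmod_morphism tpi.
Proof.
by move=> x y; rewrite /tpi [RHS]/GRing.add/= [in RHS]/GRing.opp/=
   Quotient.pi_add Quotient.pi_opp.
Qed.

HB.instance Definition _ :=
  GRing.isZmodMorphism.Build G tquot tpi tpi_is_zmod_morphism.

Lemma tpi_continuous : continuous tpi.
Proof. exact: pi_continuous. Qed.

Lemma tquot_openE (U : set tquot) : open U = open (tpi @^-1` U).
Proof. by []. Qed.

Lemma tpi_open (U : set G) : open U -> open (tpi @` U).
Proof.
move=> oU; rewrite tquot_openE.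
have -> : tpi @^-1` (tpi @` U) =
    \bigcup_(s in [set s | s \in S]) ((fun x => x + s) @^-1` U).
  apply/seteqP; split => [x [u Uu /tpiE Suv]|x [s /= sS Uxs]].
    by exists (u - x) => //=; rewrite addrC subrK.
  by exists (x + s) => //; apply/tpiE; rewrite addrC addrA addNr add0r.
apply: bigcup_open => s _; apply: open_comp => // x _.
by apply: continuous_add_fun => y; [exact: cvg_id | exact: cvg_cst].
Qed.

Lemma tquot_continuous (T : topologicalType) (f : tquot -> T) :
  continuous (fun x => f (tpi x)) -> continuous f.
Proof. by move=> /continuousP cf; apply/continuousP => U /cf. Qed.

Lemma tquot_sub_continuous : continuous (fun x : tquot * tquot => x.1 - x.2).
Proof.
apply/continuousP => U oU; rewrite openE => -[q r] /= Uqr.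
have /continuousP subo := @sub_continuous G.
have := subo _ (oU : open (tpi @^-1` U)); rewrite openE => /(_ (trepr q, trepr r)).
have Uqr' : U (tpi (trepr q - trepr r)) by rewrite raddfB /= !treprK.
move=> /(_ Uqr') [[P Q] /= [Pq Qr] PQ].
exists (tpi @` P, tpi @` Q) => /=.
  split.
    apply: (@filterS _ _ _ (tpi @` P^°)); first exact: image_subset (@interior_subset _ _).
    apply: open_nbhs_nbhs; split; first exact/tpi_open/open_interior.
    by exists (trepr q) => //; exact: treprK.
  apply: (@filterS _ _ _ (tpi @` Q^°)); first exact: image_subset (@interior_subset _ _).
  apply: open_nbhs_nbhs; split; first exact/tpi_open/open_interior.
  by exists (trepr r) => //; exact: treprK.
move=> [_ _] /= [[x Px <-] [y Qy <-]]; rewrite -raddfB.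
exact: (PQ (x, y)).
Qed.

HB.instance Definition _ :=
  PreTopologicalNmodule_isTopologicalZmodule.Build tquot tquot_sub_continuous.

End Quotient.

Section Discrete.
Variable V : zmodType.

HB.instance Definition _ := GRing.Zmodule.copy (discrete_topology V) V.

Lemma discrete_sub_continuous :
  continuous (fun x : discrete_topology V * discrete_topology V => x.1 - x.2).
Proof.
move=> [x y] U /= Uxy.
exists ([set x], [set y]) => /=; first by split; exact: discrete_set1.
by move=> [_ _] /= [-> ->]; exact: nbhs_singleton.
Qed.

HB.instance Definition _ := PreTopologicalNmodule_isTopologicalZmodule.Build
  (discrete_topology V) discrete_sub_continuous.

End Discrete.

Local Obligation Tactic := idtac.

(* [ext_inj] is the kernel of [ext_proj] in the category of topological abelian
   groups: a topological embedding with image the preimage of 0. *)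
Record extension (A B : topologicalZmodType) := Extension {
  ext_mid : topologicalZmodType ;
  ext_inj : {additive B -> ext_mid} ;
  ext_proj : {additive ext_mid -> A} ;
  ext_inj_continuous : continuous ext_inj ;
  ext_inj_injective : injective ext_inj ;
  ext_inj_embedding : forall U : set B, open U ->
    exists2 V : set ext_mid, open V & ext_inj @^-1` V = U ;
  ext_proj_continuous : continuous ext_proj ;
  ext_proj_surjective : forall a, exists x, ext_proj x = a ;
  ext_proj_open : forall U : set ext_mid, open U -> open (ext_proj @` U) ;
  ext_exact : range ext_inj = ext_proj @^-1` [set 0]
}.

Definition weak_split (A B : topologicalZmodType) (E : extension A B) :=
  exists s : A -> ext_mid E,
    [/\ continuous s, (forall a, ext_proj E (s a) = a) & s 0 = 0].

Definition ext_hom (A B : topologicalZmodType) (E F : extension A B) :=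
  exists theta : {additive ext_mid E -> ext_mid F},
    [/\ continuous theta,
        (forall b, theta (ext_inj E b) = ext_inj F b) &
        (forall x, ext_proj F (theta x) = ext_proj E x)].

Section ExtTheory.
Variables (A B : topologicalZmodType) (E : extension A B).

Lemma ext_projj b : ext_proj E (ext_inj E b) = 0.
Proof.
have : (ext_proj E @^-1` [set 0]) (ext_inj E b); last by [].
by rewrite -ext_exact; exists b.
Qed.

Lemma ext_kerP x : ext_proj E x = 0 -> exists b, x = ext_inj E b.
Proof.
move=> px; have : (ext_proj E @^-1` [set 0]) x by [].
by rewrite -ext_exact => -[b _ <-]; exists b.
Qed.

End ExtTheory.

(* For homomorphisms, being a topological embedding is a condition at 0. *)
Lemma additive_embedding (G H : topologicalZmodType) (f : {additive G -> H}) :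
  continuous f ->
  (forall W, nbhs (0 : G) W -> exists2 V, nbhs (0 : H) V & f @^-1` V `<=` W) ->
  forall U : set G, open U -> exists2 V : set H, open V & f @^-1` V = U.
Proof.
move=> cf f0 U oU.
exists (\bigcup_(V in [set V | open V /\ f @^-1` V `<=` U]) V).
  by apply: bigcup_open => V [].
apply/seteqP; split => [x [V [_ VU]] /VU //|x Ux].
have : nbhs (0 : G) ((fun y => y + x) @^-1` U).
  have := @continuous_add_fun _ G id (fun=> x) (fun x => cvg_id) (fun z => cvg_cst _) 0.
  apply; rewrite add0r; exact: open_nbhs_nbhs.
move=> /f0[V V0 VU].
exists ((fun y => y - f x) @^-1` V^°).
  split; last first.
    move=> y /= /interior_subset; rewrite -raddfB => /VU /=.
    by rewrite subrK.
  apply: open_comp (open_interior _) => y _.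
  by apply: continuous_sub_fun => z; [exact: cvg_id|exact: cvg_cst].
by rewrite /= subrr; exact: nbhs_singleton (nbhs_interior V0).
Qed.

Lemma nbhs_preim (T U : topologicalType) (f : T -> U) x V :
  continuous f -> nbhs (f x) V -> nbhs x (f @^-1` V).
Proof. by move=> cf /cf. Qed.

Section Split.
Variables A B : topologicalZmodType.

Definition split_inj (b : B) : tprod B A := (b, 0).
Definition split_proj (x : tprod B A) : A := x.2.

Fact split_inj_zmod : zmod_morphism split_inj.
Proof. by move=> x y; rewrite /split_inj; congr pair; rewrite /= subr0. Qed.
Fact split_proj_zmod : zmod_morphism split_proj. Proof. by []. Qed.

HB.instance Definition _ :=
  GRing.isZmodMorphism.Build B (tprod B A) split_inj split_inj_zmod.
HB.instance Definition _ :=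
  GRing.isZmodMorphism.Build (tprod B A) A split_proj split_proj_zmod.

Program Definition split_ext : extension A B :=
  @Extension A B (tprod B A) split_inj split_proj _ _ _ _ _ _ _.
Next Obligation.
by apply: continuous_pair => x; [exact: cvg_id|exact: cvg_cst].
Qed.
Next Obligation. by move=> x y []. Qed.
Next Obligation.
move=> U oU; exists (fst @^-1` U); last by [].
by apply: open_comp => // x _; exact: cvg_fst.
Qed.
Next Obligation. exact: continuous_snd. Qed.
Next Obligation. by move=> a; exists (0, a). Qed.
Next Obligation. exact: snd_open. Qed.
Next Obligation.
by apply/seteqP; split => [_ [b _ <-] //|[b a] /= ->]; exists b.
Qed.

Lemma split_ws : weak_split split_ext.
Proof.
exists (fun a => (0, a)); split => //.
by apply: continuous_pair => x; [exact: cvg_cst|exact: cvg_id].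
Qed.

End Split.

Section ProductExt.
Variables (A B A' B' : topologicalZmodType).
Variables (E : extension A B) (E' : extension A' B').

Let X := tprod (ext_mid E) (ext_mid E').

Definition prod_inj (b : tprod B B') : X := (ext_inj E b.1, ext_inj E' b.2).
Definition prod_proj (x : X) : tprod A A' :=
  (ext_proj E x.1, ext_proj E' x.2).

Fact prod_inj_zmod : zmod_morphism prod_inj.
Proof. by move=> x y; rewrite /prod_inj !raddfB. Qed.
Fact prod_proj_zmod : zmod_morphism prod_proj.
Proof. by move=> x y; rewrite /prod_proj !raddfB. Qed.

HB.instance Definition _ :=
  GRing.isZmodMorphism.Build (tprod B B') X prod_inj prod_inj_zmod.
HB.instance Definition _ :=
  GRing.isZmodMorphism.Build X (tprod A A') prod_proj prod_proj_zmod.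

Program Definition prod_ext : extension (tprod A A') (tprod B B') :=
  @Extension (tprod A A') (tprod B B') X prod_inj prod_proj _ _ _ _ _ _ _.
Next Obligation.
apply: continuous_pair.
  exact: continuous_compT (@continuous_fst B B') (@ext_inj_continuous _ _ E).
exact: continuous_compT (@continuous_snd B B') (@ext_inj_continuous _ _ E').
Qed.
Next Obligation.
by move=> [x x'] [y y'] [/ext_inj_injective -> /ext_inj_injective ->].
Qed.
Next Obligation.
apply: additive_embedding; first exact: prod_ext_obligation_1.
move=> W [[P P'] /= [P0 P'0] PW].
have [V oV Ve] := ext_inj_embedding E (open_interior P).
have [V' oV' Ve'] := ext_inj_embedding E' (open_interior P').
exists (V `*` V').
  exists (V, V') => //; split; apply: open_nbhs_nbhs; split => //=.
    have : (ext_inj E @^-1` V) 0 by rewrite Ve; exact: nbhs_singleton (nbhs_interior P0).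
    by rewrite /= raddf0.
  have : (ext_inj E' @^-1` V') 0 by rewrite Ve'; exact: nbhs_singleton (nbhs_interior P'0).
  by rewrite /= raddf0.
move=> [b b'] /= [Vb Vb']; apply: PW; split => /=; apply: interior_subset.
  by rewrite -Ve.
by rewrite -Ve'.
Qed.
Next Obligation.
apply: continuous_pair.
  exact: continuous_compT (@continuous_fst _ _) (@ext_proj_continuous _ _ E).
exact: continuous_compT (@continuous_snd _ _) (@ext_proj_continuous _ _ E').
Qed.
Next Obligation.
case=> a a'.
have [x <-] := ext_proj_surjective E a.
by have [x' <-] := ext_proj_surjective E' a'; exists (x, x').
Qed.
Next Obligation.
move=> U; rewrite !openE => oU _ [[x x'] Ux <-]; have := oU _ Ux.
move=> [[P P'] /= [Px P'x'] PU].
exists (ext_proj E @` P^°, ext_proj E' @` P'^°).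
  split; apply: open_nbhs_nbhs; split => /=;
    do ?[exact: ext_proj_open (open_interior _)].
    by exists x => //; exact: nbhs_singleton (nbhs_interior Px).
  by exists x' => //; exact: nbhs_singleton (nbhs_interior P'x').
move=> [_ _] /= [[y Py <-] [y' Py' <-]].
by exists (y, y') => //; apply: PU; split; exact: interior_subset.
Qed.
Next Obligation.
apply/seteqP; split => [_ [b _ <-]|[x x'] [/ext_kerP[b ->] /ext_kerP[b' ->]]].
  by rewrite /= /prod_proj /prod_inj /= !ext_projj.
by exists (b, b').
Qed.

Lemma prod_ws : weak_split E -> weak_split E' -> weak_split prod_ext.
Proof.
move=> [s [cs sK s0]] [s' [cs' sK' s0']].
exists (fun a => (s a.1, s' a.2)); split.
- apply: continuous_pair.
    exact: continuous_compT (@continuous_fst _ _) cs.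
  exact: continuous_compT (@continuous_snd _ _) cs'.
- by case=> a a'; rewrite /= /prod_proj /= sK sK'.
- by rewrite /= s0 s0'.
Qed.

End ProductExt.

(* The pushout along [f : B -> B'] has as middle group the topological quotient
   of [X * B'] by the subgroup of all [(j b, - f b)]. *)
Section Pushout.
Variables (A B B' : topologicalZmodType) (f : {additive B -> B'}).
Hypothesis cf : continuous f.
Variable E : extension A B.

Definition push_rel : {pred tprod (ext_mid E) B'} :=
  fun z => `[< exists b, z = (ext_inj E b, - f b) >].

Lemma push_relP z :
  reflect (exists b, z = (ext_inj E b, - f b)) (z \in push_rel).
Proof. exact: asboolP. Qed.

Fact push_rel_closed : zmod_closed push_rel.
Proof.
split; first by apply/push_relP; exists 0; rewrite !raddf0.
move=> _ _ /push_relP[b ->] /push_relP[c ->]; apply/push_relP; exists (b - c).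
by rewrite !raddfB.
Qed.

HB.instance Definition _ :=
  GRing.isZmodClosed.Build (tprod (ext_mid E) B') push_rel push_rel_closed.

Definition push_mid := @tquot (tprod (ext_mid E) B') push_rel.

HB.instance Definition _ := TopologicalZmodule.on push_mid.

Definition push_cls (x : ext_mid E) (b : B') : push_mid :=
  @tpi (tprod (ext_mid E) B') push_rel (x, b).

Lemma push_clsP x b y c : push_cls x b = push_cls y c <->
  exists d, x - y = ext_inj E d /\ b - c = - f d.
Proof.
rewrite /push_cls tpiE; split => [/push_relP[d [h k]]|[d [h k]]].
  by exists d.
by apply/push_relP; exists d; congr pair.
Qed.

Lemma push_clsB x b y c :
  push_cls (x - y) (b - c) = push_cls x b - push_cls y c.
Proof. by rewrite /push_cls -raddfB. Qed.

Lemma push_cls_ind (P : push_mid -> Prop) :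
  (forall x b, P (push_cls x b)) -> forall q, P q.
Proof.
by move=> h q; rewrite -(treprK q); case: (trepr q) => x b; exact: h.
Qed.

Definition push_inj (b : B') : push_mid := push_cls 0 b.
Definition push_proj (q : push_mid) : A := ext_proj E (trepr q).1.

Lemma push_projE x b : push_proj (push_cls x b) = ext_proj E x.
Proof.
have : push_cls (trepr (push_cls x b)).1 (trepr (push_cls x b)).2
   = push_cls x b by rewrite /push_cls -surjective_pairing treprK.
move=> /push_clsP[d [h _]]; apply/eqP; rewrite -subr_eq0 -raddfB h.
by rewrite ext_projj.
Qed.

Fact push_inj_zmod : zmod_morphism push_inj.
Proof. by move=> x y; rewrite /push_inj -push_clsB subr0. Qed.
Fact push_proj_zmod : zmod_morphism push_proj.
Proof.
elim/push_cls_ind => x b; elim/push_cls_ind => y c.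
by rewrite -push_clsB !push_projE raddfB.
Qed.

HB.instance Definition _ :=
  GRing.isZmodMorphism.Build B' push_mid push_inj push_inj_zmod.
HB.instance Definition _ :=
  GRing.isZmodMorphism.Build push_mid A push_proj push_proj_zmod.

Program Definition push_ext : extension A B' :=
  @Extension A B' push_mid push_inj push_proj _ _ _ _ _ _ _.
Next Obligation.
apply: (continuous_compT (f := fun b => (0, b) : tprod _ _)).
  by apply: continuous_pair => x; [exact: cvg_cst|exact: cvg_id].
exact: tpi_continuous.
Qed.
Next Obligation.
move=> b c /push_clsP[d []]; rewrite subrr -(raddf0 (ext_inj E)).
move=> /ext_inj_injective <-; rewrite raddf0 oppr0 => /eqP.
by rewrite subr_eq0 => /eqP.
Qed.
Next Obligation.
apply: additive_embedding; first exact: push_ext_obligation_1.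
move=> W W0.
have [[P Q] /= [P0 Q0] PQ] : nbhs ((0, 0) : B' * B') ((fun x => x.1 - x.2) @^-1` W).
  by apply: (@sub_continuous B' (0, 0)); rewrite subr0.
have f0 : nbhs (0 : B) (f @^-1` Q^°).
  by apply: nbhs_preim cf _; rewrite raddf0; exact: nbhs_interior.
have [V oV Ve] := ext_inj_embedding E (open_interior (f @^-1` Q^°)).
have V0 : V 0.
  have : (ext_inj E @^-1` V) 0 by rewrite Ve; exact: nbhs_singleton (nbhs_interior f0).
  by rewrite /= raddf0.
exists (@tpi (tprod (ext_mid E) B') push_rel @` ((-%R @^-1` V) `*` P^°)).
  apply: open_nbhs_nbhs; split.
    apply: tpi_open; rewrite openE => -[x b] /= [Vx Pb].
    exists (-%R @^-1` V, P^°) => //; split => /=.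
      by apply: nbhs_preim (@opp_continuous _) _; exact: open_nbhs_nbhs.
    exact: open_nbhs_nbhs (conj (open_interior _) Pb).
  exists (0, 0); last by rewrite raddf0.
  split => /=; first by rewrite oppr0.
  exact: nbhs_singleton (nbhs_interior P0).
move=> b /= [[x c] /= [Vx Pc] /push_clsP[d []]]; rewrite subr0 => xd cb.
have -> : b = c - f (- d) by rewrite raddfN -cb opprB addrC subrK.
apply: (PQ (c, f (- d))); split => /=; first exact: interior_subset.
have : (ext_inj E @^-1` V) (- d) by rewrite /= raddfN -xd.
rewrite Ve => /interior_subset /=; exact: interior_subset.
Qed.
Next Obligation.
apply: tquot_continuous => /=.
have -> : (fun x : tprod _ B' => push_proj (@tpi (tprod (ext_mid E) B') push_rel x)) =
    fun x => ext_proj E x.1.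
  by apply: funext => -[x b]; exact: push_projE.
exact: continuous_compT (@continuous_fst _ _) (@ext_proj_continuous _ _ E).
Qed.
Next Obligation.
move=> a; have [x <-] := ext_proj_surjective E a.
by exists (push_cls x 0); exact: push_projE.
Qed.
Next Obligation.
move=> U oU; have -> : push_proj @` U = ext_proj E @` (fst @` (@tpi (tprod (ext_mid E) B') push_rel @^-1` U)).
  apply/seteqP; split => [_ [q Uq <-]|_ [_ [[x b] Ux <-] <-]].
    move: q Uq; elim/push_cls_ind => x b Uq.
    by exists x; [exists (x, b)|rewrite push_projE].
  by exists (push_cls x b) => //; exact: push_projE.
apply: ext_proj_open; apply: fst_open.
by apply: open_comp => // x _; exact: tpi_continuous.
Qed.
Next Obligation.
apply/seteqP; split => [_ [b _ <-]|q]; first by rewrite /= /push_inj push_projE raddf0.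
elim/push_cls_ind: q => x b /=; rewrite push_projE => /ext_kerP[d ->].
exists (b + f d) => //; apply/push_clsP; exists (- d).
by rewrite sub0r !raddfN opprK addrC addKr.
Qed.

Lemma push_ws : weak_split E -> weak_split push_ext.
Proof.
move=> [s [cs sK s0]]; exists (fun a => push_cls (s a) 0); split.
- apply: (continuous_compT (f := fun b => (s b, 0) : tprod _ _)).
    by apply: continuous_pair => x; [exact: cs|exact: cvg_cst].
  exact: tpi_continuous.
- by move=> a; rewrite /= push_projE sK.
- by rewrite s0 /push_cls raddf0.
Qed.

End Pushout.

(* The pullback along [g : A' -> A] has as middle group the subspace of
   [A' * X] of all [(a', x)] with [g a' = p x]. *)
Section Pullback.
Variables (A A' B : topologicalZmodType) (g : {additive A' -> A}).
Hypothesis cg : continuous g.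
Variable E : extension A B.

Definition pull_rel : {pred tprod A' (ext_mid E)} :=
  fun z => g z.1 == ext_proj E z.2.

Fact pull_rel_closed : zmod_closed pull_rel.
Proof.
split; first by rewrite unfold_in /= !raddf0.
by move=> x y; rewrite !unfold_in /= !raddfB => /eqP -> /eqP ->.
Qed.

HB.instance Definition _ :=
  GRing.isZmodClosed.Build (tprod A' (ext_mid E)) pull_rel pull_rel_closed.

Definition pull_mid := @tsub (tprod A' (ext_mid E)) pull_rel.

HB.instance Definition _ := TopologicalZmodule.on pull_mid.

Lemma pull_midP (u : pull_mid) : g (val u).1 = ext_proj E (val u).2.
Proof. by have := valP u; rewrite unfold_in => /eqP. Qed.

Fact pull_inj_subproof b : ((0, ext_inj E b) : tprod _ _) \in pull_rel.
Proof. by rewrite unfold_in /= raddf0 ext_projj. Qed.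

Definition pull_inj (b : B) : pull_mid := Sub (0, ext_inj E b) (pull_inj_subproof b).
Definition pull_proj (u : pull_mid) : A' := (val u).1.

Fact pull_inj_zmod : zmod_morphism pull_inj.
Proof.
by move=> x y; apply: val_inj; rewrite /= raddfB; congr pair;
   rewrite subr0.
Qed.
Fact pull_proj_zmod : zmod_morphism pull_proj.
Proof. by []. Qed.

HB.instance Definition _ :=
  GRing.isZmodMorphism.Build B pull_mid pull_inj pull_inj_zmod.
HB.instance Definition _ :=
  GRing.isZmodMorphism.Build pull_mid A' pull_proj pull_proj_zmod.

Program Definition pull_ext : extension A' B :=
  @Extension A' B pull_mid pull_inj pull_proj _ _ _ _ _ _ _.
Next Obligation.
apply: tsub_continuous; apply: continuous_pair => x; first exact: cvg_cst.
exact: ext_inj_continuous.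
Qed.
Next Obligation.
by move=> b c /(congr1 val) /= [/ext_inj_injective].
Qed.
Next Obligation.
move=> U oU; have [V oV <-] := ext_inj_embedding E oU.
exists (fun u => V (val u).2); last by [].
exists (snd @^-1` V); last by [].
by apply: open_comp oV => x _; exact: cvg_snd.
Qed.
Next Obligation.
apply: continuous_compT (@tsub_val_continuous _ pull_rel) _.
exact: continuous_fst.
Qed.
Next Obligation.
move=> a; have [x px] := ext_proj_surjective E (g a).
have ax : ((a, x) : tprod _ _) \in pull_rel by rewrite unfold_in /= px.
by exists (Sub (a, x) ax).
Qed.
Next Obligation.
move=> U [V oV <-]; rewrite openE => _ [u Vu <-].
move: oV; rewrite openE => /(_ _ Vu) [[P Q] /= [Pu Qu] PQ].
have gP : nbhs (pull_proj u) (g @^-1` (ext_proj E @` Q^°)).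
  apply: (@cg (pull_proj u)); rewrite /= [g _]pull_midP.
  apply: open_nbhs_nbhs; split; first exact: ext_proj_open (open_interior _).
  by exists (val u).2 => //; exact: nbhs_singleton (nbhs_interior Qu).
apply: (filterS _ (filterI Pu gP)) => a [Pa [x Qx px]].
have ax : ((a, x) : tprod _ _) \in pull_rel by rewrite unfold_in /= px.
by exists (Sub (a, x) ax) => //; apply: PQ; split => //; exact: interior_subset.
Qed.
Next Obligation.
apply/seteqP; split => [_ [b _ <-] //|u /= u0].
have [b ub] : exists b, (val u).2 = ext_inj E b.
  by apply: ext_kerP; rewrite -pull_midP [(val u).1]u0 raddf0.
exists b => //; apply: val_inj => /=.
by rewrite -ub -[in LHS](u0 : (val u).1 = 0) -surjective_pairing.
Qed.

Lemma pull_ws : weak_split E -> weak_split pull_ext.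
Proof.
move=> [s [cs sK s0]].
have h a : ((a, s (g a)) : tprod _ _) \in pull_rel by rewrite unfold_in /= sK.
exists (fun a => Sub (a, s (g a)) (h a) : pull_mid); split => //.
- apply: tsub_continuous; apply: continuous_pair => x; first exact: cvg_id.
  exact: continuous_compT cg cs x.
- by apply: val_inj; rewrite /= raddf0 s0.
Qed.

End Pullback.

Section Baer.
Variables A B : topologicalZmodType.

Definition nabla (b : tprod B B) : B := b.1 + b.2.
Definition diag (a : A) : tprod A A := (a, a).

Fact nabla_zmod : zmod_morphism nabla.
Proof. by move=> x y; rewrite /nabla /= opprD addrACA. Qed.
Fact diag_zmod : zmod_morphism diag.
Proof. by []. Qed.

HB.instance Definition _ :=
  GRing.isZmodMorphism.Build (tprod B B) B nabla nabla_zmod.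
HB.instance Definition _ :=
  GRing.isZmodMorphism.Build A (tprod A A) diag diag_zmod.

Lemma nabla_continuous : continuous nabla.
Proof. exact: add_continuous. Qed.

Lemma diag_continuous : continuous diag.
Proof. by apply: continuous_pair => x; exact: cvg_id. Qed.

Definition baer (E E' : extension A B) : extension A B :=
  pull_ext diag_continuous (push_ext nabla_continuous (prod_ext E E')).

Lemma baer_ws E E' : weak_split E -> weak_split E' -> weak_split (baer E E').
Proof. by move=> wE wE'; apply/pull_ws/push_ws/prod_ws. Qed.

End Baer.

Record ws_extension (A B : topologicalZmodType) := WsExtension {
  ws_ext :> extension A B ;
  ws_extP : weak_split ws_ext
}.

Definition ws_split (A B : topologicalZmodType) : ws_extension A B :=
  WsExtension (split_ws A B).

Definition ws_baer (A B : topologicalZmodType) (E F : ws_extension A B) :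
    ws_extension A B :=
  WsExtension (baer_ws (ws_extP E) (ws_extP F)).

Definition ws_equiv (A B : topologicalZmodType) :
    ws_extension A B -> ws_extension A B -> Prop :=
  clos_refl_sym_trans (ws_extension A B) (fun E F => ext_hom E F).

Section Equivalence.
Variables A B : topologicalZmodType.
Implicit Types E F G : ws_extension A B.

Lemma ws_equiv_hom E F : ext_hom E F -> ws_equiv E F.
Proof. by move=> h; apply: rst_step. Qed.

Lemma ws_equiv_refl E : ws_equiv E E. Proof. exact: rst_refl. Qed.

Lemma ws_equiv_sym E F : ws_equiv E F -> ws_equiv F E.
Proof. exact: rst_sym. Qed.

Lemma ws_equiv_trans F E G : ws_equiv E F -> ws_equiv F G -> ws_equiv E G.
Proof. exact: rst_trans. Qed.

Lemma ws_equiv_map (f : ws_extension A B -> ws_extension A B) E F :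
  (forall X Y : ws_extension A B, ext_hom X Y -> ext_hom (f X) (f Y)) ->
  ws_equiv E F -> ws_equiv (f E) (f F).
Proof.
move=> fhom EF.
induction EF as [X Y XY|X|X Y _ h|X Y Z _ h _ h'].
- apply: ws_equiv_hom; exact: fhom XY.
- exact: ws_equiv_refl.
- exact: ws_equiv_sym.
- exact: ws_equiv_trans h h'.
Qed.

End Equivalence.

Lemma section_continuous (A B : topologicalZmodType) (E F : extension A B)
    (s : A -> ext_mid E) (g : {additive ext_mid E -> ext_mid F}) :
  continuous s -> (forall a, ext_proj E (s a) = a) ->
  (forall b, g (ext_inj E b) = ext_inj F b) ->
  continuous (fun a => g (s a)) -> continuous g.
Proof.
move=> cs sK gj cgs.
have H x : exists b, x - s (ext_proj E x) = ext_inj E b.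
  by apply: ext_kerP; rewrite raddfB /= sK subrr.
have [r rE] := choice H.
have cr : continuous r.
  apply/continuousP => U oU; have [V oV VU] := ext_inj_embedding E oU.
  have -> : r @^-1` U = (fun x => x - s (ext_proj E x)) @^-1` V.
    by apply/seteqP; split => x /=; rewrite rE -VU.
  apply: open_comp oV => x _; apply: continuous_sub_fun => y.
    exact: cvg_id.
  exact: continuous_compT (@ext_proj_continuous _ _ E) cs y.
have -> : (g : ext_mid E -> ext_mid F)
    = fun x => ext_inj F (r x) + g (s (ext_proj E x)).
  by apply: funext => x; rewrite -gj -rE -raddfD subrK.
apply: continuous_add_fun.
  exact: continuous_compT cr (@ext_inj_continuous _ _ F).
exact: continuous_compT (@ext_proj_continuous _ _ E) cgs.
Qed.

Section BaerElements.
Variables (A B : topologicalZmodType) (E F : extension A B).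

Local Notation fib x y := (ext_proj E x = ext_proj F y).

(* The class of ((x, y), b), over the common image of x and y in A. *)
Definition baer_cls (x : ext_mid E) (y : ext_mid F) (b : B) :
    ext_mid (baer E F) :=
  insubd (0 : ext_mid (baer E F))
    ((ext_proj E x, @push_cls _ _ _ (@nabla B) (prod_ext E F) (x, y) b)
      : tprod A (ext_mid (push_ext (@nabla_continuous B) (prod_ext E F)))).

Lemma baer_clsE x y b : fib x y ->
  val (baer_cls x y b) =
  (ext_proj E x, @push_cls _ _ _ (@nabla B) (prod_ext E F) (x, y) b).
Proof.
move=> xy; rewrite val_insubd ifT // unfold_in /=.
by rewrite [push_proj _]push_projE /= /prod_proj -xy.
Qed.

Lemma baer_cls_ind (P : ext_mid (baer E F) -> Prop) :
  (forall x y b, fib x y -> P (baer_cls x y b)) -> forall u, P u.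
Proof.
move=> h u; have := pull_midP u.
case Du: (val u) => [a q] /=.
move: q Du; elim/push_cls_ind => -[x y] b Du.
rewrite [push_proj _]push_projE /= => -[ax ay].
have xy : fib x y by rewrite -ax -ay.
suff -> : u = baer_cls x y b by exact: h.
by apply: val_inj; rewrite baer_clsE // Du ax.
Qed.

Lemma baer_cls_eq x y b x' y' b' : fib x y -> fib x' y' ->
  (baer_cls x y b = baer_cls x' y' b' <->
   exists d e, [/\ x - x' = ext_inj E d, y - y' = ext_inj F e &
                   b - b' = - (d + e)]).
Proof.
move=> xy xy'; split.
  move=> /(congr1 val); rewrite !baer_clsE // => -[_ /push_clsP[[d e]]].
  by move=> [] /= [xd ye] bb; exists d, e.
move=> [d [e [xd ye bb]]]; apply: val_inj; rewrite !baer_clsE //.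
congr pair; last first.
  by apply/push_clsP; exists (d, e); split => //; congr pair.
by apply/eqP; rewrite -subr_eq0 -raddfB xd ext_projj.
Qed.

Lemma fibB x y x' y' : fib x y -> fib x' y' -> fib (x - x') (y - y').
Proof. by rewrite !raddfB => -> ->. Qed.

Lemma baer_clsB x y b x' y' b' : fib x y -> fib x' y' ->
  baer_cls (x - x') (y - y') (b - b') = baer_cls x y b - baer_cls x' y' b'.
Proof.
move=> xy xy'; apply: val_inj; rewrite raddfB /= !baer_clsE //; last exact: fibB.
by rewrite raddfB; congr pair; rewrite -push_clsB.
Qed.

Lemma baer_inj_cls b : ext_inj (baer E F) b = baer_cls 0 0 b.
Proof.
by apply: val_inj; rewrite baer_clsE ?raddf0.
Qed.

Lemma baer_proj_cls x y b : fib x y ->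
  ext_proj (baer E F) (baer_cls x y b) = ext_proj E x.
Proof. by move=> xy; rewrite /= /pull_proj baer_clsE. Qed.

Lemma baer_cls_inj d e b :
  baer_cls (ext_inj E d) (ext_inj F e) b = ext_inj (baer E F) (d + e + b).
Proof.
have h : fib (ext_inj E d) (ext_inj F e) by rewrite !ext_projj.
have h0 : fib 0 0 by rewrite !raddf0.
rewrite baer_inj_cls; apply/baer_cls_eq => //; exists d, e.
by rewrite !subr0; split=> //; rewrite opprD addrCA subrr addr0.
Qed.

Lemma baer_cls_continuous (T : topologicalType) (f : T -> ext_mid E)
    (g : T -> ext_mid F) (h : T -> B) :
  (forall t, fib (f t) (g t)) ->
  continuous f -> continuous g -> continuous h ->
  continuous (fun t => baer_cls (f t) (g t) (h t)).
Proof.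
move=> fg cf cg ch; apply: tsub_continuous.
have -> : (fun t => val (baer_cls (f t) (g t) (h t))) = fun t =>
  (ext_proj E (f t), @push_cls _ _ _ (@nabla B) (prod_ext E F) (f t, g t) (h t)).
  by apply: funext => t; rewrite baer_clsE.
apply: continuous_pair.
  exact: continuous_compT cf (@ext_proj_continuous _ _ E).
apply: (continuous_compT
  (f := fun t => ((f t, g t), h t) : tprod (tprod (ext_mid E) (ext_mid F)) B)).
  by apply: continuous_pair => //; exact: continuous_pair.
exact: tpi_continuous.
Qed.

Lemma baer_lift (G : extension A B)
    (theta : ext_mid E -> ext_mid F -> ext_mid G) :
  (forall x y x' y', fib x y -> fib x' y' ->
     theta (x - x') (y - y') = theta x y - theta x' y') ->
  (forall d e, theta (ext_inj E d) (ext_inj F e) = ext_inj G (d + e)) ->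
  (forall x y, fib x y -> ext_proj G (theta x y) = ext_proj E x) ->
  (exists s t, [/\ continuous s, continuous t,
     (forall a, ext_proj E (s a) = a), (forall a, ext_proj F (t a) = a) &
     continuous (fun a => theta (s a) (t a))]) ->
  ext_hom (baer E F) G.
Proof.
move=> thB thj pth [s [t [cs ct sK tK cst]]].
have H u : exists w, forall x y b, fib x y -> u = baer_cls x y b ->
    w = theta x y + ext_inj G b.
  elim/baer_cls_ind: u => x y b xy; exists (theta x y + ext_inj G b).
  move=> x' y' b' xy' /(baer_cls_eq _ _ xy xy')[d [e [xd ye bb]]].
  apply/eqP; rewrite -subr_eq0 opprD addrACA -thB // xd ye thj -raddfB bb.
  by rewrite -raddfD subrr raddf0.
have [g gE] := choice H.
have gcls x y b : fib x y -> g (baer_cls x y b) = theta x y + ext_inj G b.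
  by move=> xy; apply: gE.
have gB : zmod_morphism g.
  elim/baer_cls_ind => x y b xy; elim/baer_cls_ind => x' y' b' xy'.
  rewrite -baer_clsB // !gcls //; last exact: fibB.
  by rewrite thB // raddfB opprD addrACA.
pose gm := GRing.isZmodMorphism.Build _ _ g gB.
pose ga : {additive ext_mid (baer E F) -> ext_mid G} := HB.pack g gm.
have f0 : fib 0 0 by rewrite !raddf0.
have gj b : ga (ext_inj (baer E F) b) = ext_inj G b.
  have th0 : theta 0 0 = 0.
    by have := thj 0 0; rewrite addr0 !raddf0.
  by rewrite baer_inj_cls /= gcls // th0 add0r.
have st a : fib (s a) (t a) by rewrite sK tK.
exists ga; split => //.
- apply: (@section_continuous _ _ (baer E F) G
    (fun a => baer_cls (s a) (t a) 0) ga) => //.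
  + by apply: baer_cls_continuous => // x; exact: cvg_cst.
  + by move=> a; rewrite baer_proj_cls.
  + have -> // : (fun a => ga (baer_cls (s a) (t a) 0))
      = fun a => theta (s a) (t a).
    by apply: funext => a; rewrite /= gcls // raddf0 addr0.
- elim/baer_cls_ind => x y b xy; rewrite baer_proj_cls //= gcls //.
  by rewrite raddfD /= ext_projj addr0 pth.
Qed.

End BaerElements.

Section BaerLaws.
Variables A B : topologicalZmodType.
Implicit Types E F G : ws_extension A B.

Lemma ws_baer_hom E F E' F' : ext_hom E E' -> ext_hom F F' ->
  ext_hom (ws_baer E F) (ws_baer E' F').
Proof.
move=> [f [cf fj pf]] [g [cg gj pg]].
have fibfg x y : ext_proj E x = ext_proj F y ->
  ext_proj E' (f x) = ext_proj F' (g y) by rewrite pf pg.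
apply: (baer_lift (theta := fun x y => baer_cls (f x) (g y) 0)).
- move=> x y x' y' xy xy'; rewrite !raddfB -baer_clsB ?subrr //; exact: fibfg.
- by move=> d e; rewrite fj gj baer_cls_inj addr0.
- by move=> x y xy; rewrite baer_proj_cls ?pf ?pg.
have [s [cs sK _]] := ws_extP E; have [t [ct tK _]] := ws_extP F.
exists s, t; split => //; apply: baer_cls_continuous.
- by move=> a; apply: fibfg; rewrite sK tK.
- exact: continuous_compT cs cf.
- exact: continuous_compT ct cg.
- by move=> x; exact: cvg_cst.
Qed.

Lemma ext_hom_refl E : ext_hom E E.
Proof. by exists idfun; split => // x; exact: cvg_id. Qed.

Lemma ws_baer_equiv E F E' F' : ws_equiv E E' -> ws_equiv F F' ->
  ws_equiv (ws_baer E F) (ws_baer E' F').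
Proof.
move=> EE' FF'; apply: (@ws_equiv_trans _ _ (ws_baer E' F)).
  apply: (ws_equiv_map (f := fun X => ws_baer X F)) EE' => X Y XY.
  by apply: ws_baer_hom => //; exact: ext_hom_refl.
apply: ws_equiv_map FF' => X Y XY.
by apply: ws_baer_hom => //; exact: ext_hom_refl.
Qed.

Lemma ws_baerC E F : ws_equiv (ws_baer E F) (ws_baer F E).
Proof.
apply: ws_equiv_hom.
apply: (baer_lift (theta := fun x y => baer_cls y x 0)).
- by move=> x y x' y' xy xy'; rewrite -baer_clsB ?subrr.
- by move=> d e; rewrite baer_cls_inj addr0 addrC.
- by move=> x y xy; rewrite baer_proj_cls.
have [s [cs sK _]] := ws_extP E; have [t [ct tK _]] := ws_extP F.
exists s, t; split => //; apply: baer_cls_continuous => //.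
  by move=> a; rewrite sK tK.
by move=> x; exact: cvg_cst.
Qed.

Lemma ws_baer0 E : ws_equiv (ws_baer (ws_split A B) E) E.
Proof.
apply: ws_equiv_hom.
apply: (baer_lift (E := ws_split A B)
  (theta := fun (x : tprod B A) y => ext_inj E x.1 + y)).
- by move=> x y x' y' _ _; rewrite /= raddfB opprD addrACA.
- by move=> d e; rewrite /= raddfD.
- by move=> x y /= xy; rewrite raddfD /= ext_projj add0r.
have [t [ct tK _]] := ws_extP E.
exists (fun a => (0, a)), t; split => //=.
  by apply: continuous_pair => x; [exact: cvg_cst|exact: cvg_id].
have -> // : (fun a => ext_inj E 0 + t a) = t.
by apply: funext => a; rewrite raddf0 add0r.
Qed.

Lemma ws_baerA E F G :
  ws_equiv (ws_baer E (ws_baer F G)) (ws_baer (ws_baer E F) G).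
Proof.
apply/ws_equiv_sym/ws_equiv_hom.
pose k x y z : ext_mid (ws_baer E (ws_baer F G)) :=
  baer_cls x (baer_cls (E := F) (F := G) y z 0) 0.
have fibyz x y z : ext_proj E x = ext_proj F y -> ext_proj E x = ext_proj G z ->
  ext_proj E x = ext_proj (baer F G) (baer_cls y z 0).
  by move=> xy xz; rewrite baer_proj_cls // -xy.
have kB x y z x' y' z' :
   ext_proj E x = ext_proj F y -> ext_proj E x = ext_proj G z ->
   ext_proj E x' = ext_proj F y' -> ext_proj E x' = ext_proj G z' ->
   k (x - x') (y - y') (z - z') = k x y z - k x' y' z'.
  move=> xy xz xy' xz'; rewrite /k.
  rewrite -baer_clsB; [|exact: fibyz..].
  rewrite -baer_clsB ?subrr //.
    by rewrite -xy -xz.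
  by rewrite -xy' -xz'.
have kj b c d : k (ext_inj E b) (ext_inj F c) (ext_inj G d) =
    ext_inj (ws_baer E (ws_baer F G)) (b + c + d).
  by rewrite /k baer_cls_inj addr0 (@baer_cls_inj _ _ E (baer F G)) addr0 addrA.
have H (uz : ext_mid (ws_baer E F) * ext_mid G) : exists w,
    ext_proj (ws_baer E F) uz.1 = ext_proj G uz.2 ->
    forall x y b, ext_proj E x = ext_proj F y -> uz.1 = baer_cls x y b ->
    w = k x y uz.2 + ext_inj (ws_baer E (ws_baer F G)) b.
  case: uz => u z; elim/baer_cls_ind: u => x y b xy.
  exists (k x y z + ext_inj (ws_baer E (ws_baer F G)) b) => /=.
  rewrite [pull_proj _]baer_proj_cls // => xz.
  move=> x' y' b' xy' bb; have xx' : ext_proj E x = ext_proj E x'.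
    by rewrite -(baer_proj_cls b xy) bb baer_proj_cls.
  move: bb => /(baer_cls_eq _ _ xy xy')[d [e [xd ye bb]]].
  have xz' : ext_proj E x' = ext_proj G z by rewrite -xx'.
  apply/eqP; rewrite -subr_eq0 opprD addrACA -kB // xd ye subrr.
  rewrite -(raddf0 (ext_inj G)) kj -raddfB bb.
  by rewrite -raddfD addr0 subrr raddf0.
have [h hE] := choice H.
have hcls x y b z : ext_proj E x = ext_proj F y -> ext_proj E x = ext_proj G z ->
  h (baer_cls x y b, z) = k x y z + ext_inj (ws_baer E (ws_baer F G)) b.
  move=> xy xz; apply: hE => //=.
  by rewrite [pull_proj _]baer_proj_cls.
apply: (baer_lift (E := ws_baer E F) (theta := fun u z => h (u, z))).
- move=> u z u' z'; elim/baer_cls_ind: u => x y b xy.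
  elim/baer_cls_ind: u' => x' y' b' xy'.
  rewrite !baer_proj_cls // => xz xz'.
  rewrite -baer_clsB // !hcls //; try by rewrite !raddfB /= -?xy -?xy' -?xz -?xz'.
  by rewrite kB // raddfB opprD addrACA.
- move=> d e; rewrite baer_inj_cls hcls ?ext_projj ?raddf0 //.
  rewrite -(raddf0 (ext_inj E)) -(raddf0 (ext_inj F)) kj !add0r.
  by rewrite -raddfD addrC.
- move=> u z; elim/baer_cls_ind: u => x y b xy.
  rewrite baer_proj_cls // => xz; rewrite hcls // raddfD ext_projj addr0.
  by rewrite /k baer_proj_cls //; exact: fibyz.
have [s [cs sK _]] := ws_extP E; have [t [ct tK _]] := ws_extP F.
have [r [cr rK _]] := ws_extP G.
exists (fun a => baer_cls (s a) (t a) 0), r; split => //.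
- apply: baer_cls_continuous => // a; first by rewrite sK tK.
  exact: cvg_cst.
- by move=> a; rewrite baer_proj_cls ?sK ?tK.
have -> : (fun a => h (baer_cls (s a) (t a) 0, r a)) =
    fun a => k (s a) (t a) (r a).
  by apply: funext => a; rewrite hcls ?sK ?tK ?rK // raddf0 addr0.
apply: baer_cls_continuous => //.
- by move=> a; apply: fibyz; rewrite ?sK ?tK ?rK.
- apply: baer_cls_continuous => // a; first by rewrite tK rK.
  exact: cvg_cst.
- by move=> a; exact: cvg_cst.
Qed.

End BaerLaws.

Section Opposite.
Variables A B : topologicalZmodType.

Section OppositeExtension.
Variable E : extension A B.

Definition opp_inj (b : B) : ext_mid E := - ext_inj E b.

Fact opp_inj_zmod : zmod_morphism opp_inj.
Proof. by move=> x y; rewrite /opp_inj raddfB opprD. Qed.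

HB.instance Definition _ :=
  GRing.isZmodMorphism.Build B (ext_mid E) opp_inj opp_inj_zmod.

Program Definition opp_ext : extension A B :=
  @Extension A B (ext_mid E) opp_inj (ext_proj E) _ _ _
    (@ext_proj_continuous _ _ E) (@ext_proj_surjective _ _ E)
    (@ext_proj_open _ _ E) _.
Next Obligation.
exact: continuous_opp_fun (@ext_inj_continuous _ _ E).
Qed.
Next Obligation. by move=> x y /oppr_inj /ext_inj_injective. Qed.
Next Obligation.
move=> U oU; have [V oV <-] := ext_inj_embedding E oU.
exists (-%R @^-1` V).
  by apply: open_comp oV => x _; exact: opp_continuous.
by apply/seteqP; split => b /=; rewrite /opp_inj opprK.
Qed.
Next Obligation.
rewrite -ext_exact; apply/seteqP; split => _ [b _ <-]; exists (- b) => //.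
  by rewrite /= /opp_inj raddfN.
by rewrite /= /opp_inj raddfN opprK.
Qed.

End OppositeExtension.

Lemma opp_ws (E : extension A B) : weak_split E -> weak_split (opp_ext E).
Proof. by []. Qed.

Definition ws_opp (E : ws_extension A B) : ws_extension A B :=
  WsExtension (opp_ws (ws_extP E)).

Lemma ws_opp_hom (E F : ws_extension A B) : ext_hom E F -> ext_hom (ws_opp E) (ws_opp F).
Proof.
move=> [f [cf fj pf]]; exists f; split => // b.
by rewrite /= /opp_inj raddfN fj.
Qed.

Lemma ws_opp_equiv (E F : ws_extension A B) : ws_equiv E F -> ws_equiv (ws_opp E) (ws_opp F).
Proof. by apply: ws_equiv_map => X Y; exact: ws_opp_hom. Qed.

Lemma ws_baerN (E : ws_extension A B) : ws_equiv (ws_baer (ws_opp E) E) (ws_split A B).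
Proof.
apply: ws_equiv_hom.
have H (xy : ext_mid E * ext_mid E) : exists b,
  ext_proj E xy.1 = ext_proj E xy.2 -> xy.2 - xy.1 = ext_inj E b.
  have [h|h] := pselect (ext_proj E xy.1 = ext_proj E xy.2); last by exists 0.
  have [|b hb] := @ext_kerP _ _ E (xy.2 - xy.1); last by exists b.
  by rewrite raddfB h subrr.
have [r rE] := choice H.
have jr x y : ext_proj E x = ext_proj E y -> ext_inj E (r (x, y)) = y - x.
  by move=> xy; rewrite -(rE (x, y) xy).
have ji := @ext_inj_injective _ _ E.
apply: (baer_lift (E := ws_opp E) (F := E) (G := ws_split A B)
  (theta := fun x y => (r (x, y), ext_proj E x) : tprod B A)).
- move=> x y x' y' /= xy xy'; congr pair; last by rewrite raddfB.
  apply: ji; rewrite raddfB /= !jr //; last by rewrite !raddfB xy xy'.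
  by rewrite opprD addrACA opprD.
- move=> d e; rewrite /= /opp_inj; congr pair; last first.
    by rewrite raddfN /= ext_projj oppr0.
  apply: ji; rewrite jr; first by rewrite opprK -raddfD addrC.
  by rewrite raddfN /= !ext_projj oppr0.
- by [].
have [s [cs sK _]] := ws_extP E.
exists s, s; split => //=.
have -> : (fun a => (r (s a, s a), ext_proj E (s a))) = fun a => (0, a).
  apply: funext => a; congr pair; last exact: sK.
  by apply: ji; rewrite jr // subrr raddf0.
by apply: continuous_pair => x; [exact: cvg_cst|exact: cvg_id].
Qed.

End Opposite.

(* Abelian groups without MathComp's choice structure: the carrier of
   [Ews] below is too large a type to be a [zmodType]. *)
Record abGroup := AbGroup {
  ab_sort :> Type ;
  ab_zero : ab_sort ;
  ab_opp : ab_sort -> ab_sort ;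
  ab_add : ab_sort -> ab_sort -> ab_sort ;
  ab_addA : associative ab_add ;
  ab_addC : commutative ab_add ;
  ab_add0 : left_id ab_zero ab_add ;
  ab_addN : left_inverse ab_zero ab_opp ab_add
}.

Program Definition trivial_group : abGroup :=
  @AbGroup unit tt id (fun _ _ => tt) _ _ _ _.
Solve All Obligations with by repeat case.

Definition ab_isomorphic (G H : abGroup) :=
  exists f : G -> H, bijective f /\ {morph f : x y / ab_add x y >-> ab_add x y}.

Section WsClasses.
Variables A B : topologicalZmodType.
Implicit Types E F G : ws_extension A B.

(* An equivalence class of weakly split extensions, as a predicate. *)
Record ws_class := WsClass {
  ws_mem : ws_extension A B -> Prop ;
  ws_memP : exists E, ws_mem = ws_equiv E
}.

Definition ws_cls E : ws_class := WsClass (ex_intro _ E erefl).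

Lemma ws_clsP (c : ws_class) : exists E, c = ws_cls E.
Proof.
case: c => m [E mE]; exists E; move: (ex_intro _ _ _); rewrite mE => h.
by rewrite /ws_cls (Prop_irrelevance h (ex_intro _ E erefl)).
Qed.

Lemma ws_equiv_ext E F : ws_equiv E F -> ws_equiv E = ws_equiv F.
Proof.
move=> EF; apply: funext => G; apply: propext; split.
  exact: ws_equiv_trans (ws_equiv_sym EF).
exact: ws_equiv_trans EF.
Qed.

Lemma ws_cls_eq E F : ws_cls E = ws_cls F <-> ws_equiv E F.
Proof.
split=> [/(congr1 ws_mem) /= EF|/ws_equiv_ext EF].
  by rewrite EF; exact: ws_equiv_refl.
rewrite /ws_cls; move: (ex_intro _ E _); rewrite EF => h.
by rewrite (Prop_irrelevance h (ex_intro _ F erefl)).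
Qed.

Fact ws_add_subproof (c d : ws_class) : exists G,
  (fun H => exists E F, [/\ ws_mem c E, ws_mem d F & ws_equiv (ws_baer E F) H])
  = ws_equiv G.
Proof.
have [[E ->] [F ->]] := (ws_clsP c, ws_clsP d).
exists (ws_baer E F); apply: funext => H; apply: propext; split => /=.
  move=> [E' [F' [EE' FF']]]; apply: ws_equiv_trans.
  exact: ws_baer_equiv.
by exists E, F; split => //; exact: ws_equiv_refl.
Qed.

(* [G] lies in [c + d] when it is equivalent to the Baer sum of some members
   of [c] and [d]; see [ws_addE]. *)
Definition ws_add (c d : ws_class) : ws_class := WsClass (ws_add_subproof c d).

Lemma ws_addE E F : ws_add (ws_cls E) (ws_cls F) = ws_cls (ws_baer E F).
Proof.
have [G h] := ws_clsP (ws_add (ws_cls E) (ws_cls F)).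
rewrite h; apply/ws_cls_eq/ws_equiv_sym; move/(congr1 ws_mem): h => /= h.
have : ws_equiv G G by exact: ws_equiv_refl.
rewrite -{1}h => -[E' [F' [EE' FF']]]; apply: ws_equiv_trans.
exact: ws_baer_equiv.
Qed.

Fact ws_neg_subproof (c : ws_class) : exists G,
  (fun H => exists E, ws_mem c E /\ ws_equiv (ws_opp E) H) = ws_equiv G.
Proof.
have [E ->] := ws_clsP c.
exists (ws_opp E); apply: funext => H; apply: propext; split => /=.
  by move=> [E' [EE']]; apply: ws_equiv_trans; exact: ws_opp_equiv.
by exists E; split => //; exact: ws_equiv_refl.
Qed.

Definition ws_neg (c : ws_class) : ws_class := WsClass (ws_neg_subproof c).

Lemma ws_negE E : ws_neg (ws_cls E) = ws_cls (ws_opp E).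
Proof.
have [G h] := ws_clsP (ws_neg (ws_cls E)).
rewrite h; apply/ws_cls_eq/ws_equiv_sym; move/(congr1 ws_mem): h => /= h.
have : ws_equiv G G by exact: ws_equiv_refl.
by rewrite -{1}h => -[E' [EE']]; apply: ws_equiv_trans; exact: ws_opp_equiv.
Qed.

Program Definition Ews : abGroup :=
  @AbGroup ws_class (ws_cls (ws_split A B)) ws_neg ws_add _ _ _ _.
Next Obligation.
move=> c d e; have [[E ->] [F ->] ] := (ws_clsP c, ws_clsP d).
have [G ->] := ws_clsP e.
by rewrite !ws_addE; apply/ws_cls_eq/ws_baerA.
Qed.
Next Obligation.
move=> c d; have [[E ->] [F ->] ] := (ws_clsP c, ws_clsP d).
by rewrite !ws_addE; apply/ws_cls_eq/ws_baerC.
Qed.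
Next Obligation.
move=> c; have [E ->] := ws_clsP c.
by rewrite ws_addE; apply/ws_cls_eq/ws_baer0.
Qed.
Next Obligation.
move=> c; have [E ->] := ws_clsP c.
by rewrite ws_negE ws_addE; apply/ws_cls_eq/ws_baerN.
Qed.

End WsClasses.

Definition ZZ : topologicalZmodType := discrete_topology int.

(* [dvdz n] is the subgroup nZ, so [Zmod 0] is isomorphic to Z. *)
Definition Zmod (n : nat) : topologicalZmodType :=
  discrete_topology {ideal_quot (GRing.ZmodClosed.clone int (dvdz n) _)}.

(* [rat^o] carries the topology of the absolute value, and
   [Num.int_num_subdef] is the predicate behind [Num.int]. *)
Definition QQmodZZ : topologicalZmodType :=
  @tquot rat^o (GRing.ZmodClosed.clone rat (@Num.int_num_subdef rat) _).

(* Main.v *)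
(** The extension Z -> Q -> Q/Z has a continuous section: cutting Q at the
   irrational points of 1/sqrt 2 + Z gives a clopen fundamental domain of Q
   modulo Z. Pushing it out along Z -> Z/n gives a ws-extension of Z/n. A
   retraction of either onto its kernel would extend Z -> Z/n (Z -> Z for the
   first) to Q, so that the image of 1 would be divisible by every positive
   integer; this fails for n, or for 2 if n = 0. Having an additive retraction
   is invariant under the equivalence of extensions. *)
Require Import Defs.
From mathcomp Require Import all_boot.
From HB Require Import structures.
From mathcomp Require Import all_order all_algebra ring_quotient lra zify.
From mathcomp Require Import all_classical reals topology normedtype.
Import numFieldNormedType.Exports.

Set Implicit Arguments.
Unset Strict Implicit.
Unset Printing Implicit Defensive.

Import Order.TTheory GRing.Theory Num.Theory.
Local Open Scope classical_set_scope.
Local Open Scope ring_scope.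

(** * Splittings of the underlying abelian groups, regardless of topology *)

Definition has_retraction (A B : topologicalZmodType) (E : extension A B) :=
  exists2 r : ext_mid E -> B, zmod_morphism r & forall b, r (ext_inj E b) = b.

Definition has_section (A B : topologicalZmodType) (E : extension A B) :=
  exists2 s : A -> ext_mid E, zmod_morphism s & forall a, ext_proj E (s a) = a.

Section Splitting.
Variables A B : topologicalZmodType.
Implicit Types E F : extension A B.

(** From [r], lift [a] to any [t a] and subtract [ext_inj E (r (t a))]: the result is independent of
    the lift, hence additive in [a]. From [s], the element [x - s (ext_proj E x)] lies in the kernel
    and yields [r x]. *)
Lemma has_retraction_section E : has_retraction E <-> has_section E.
Proof.
split=> [[r rB rj]|[s sB sp]].
  have [t tp] := choice (ext_proj_surjective E).
  have tE x y : ext_proj E x = ext_proj E y ->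
      x - ext_inj E (r x) = y - ext_inj E (r y).
    move=> xy; have [|b xyb] := @ext_kerP _ _ E (x - y).
      by rewrite raddfB xy subrr.
    have {}xyb : x - y = ext_inj E (r x) - ext_inj E (r y).
      by rewrite -raddfB -rB xyb rj.
    rewrite -{1}(subrK y x) xyb [_ - ext_inj E (r y)]addrC.
    by rewrite -(addrA (- _)) (addrC _ y) addrA addrK addrC.
  exists (fun a => t a - ext_inj E (r (t a))) => [a b|a]; last first.
    by rewrite raddfB /= ext_projj subr0 tp.
  rewrite (tE _ (t a - t b)); last by rewrite raddfB !tp.
  by rewrite rB raddfB !opprD addrACA.
have H x : exists b, x - s (ext_proj E x) = ext_inj E b.
  by apply: ext_kerP; rewrite raddfB sp subrr.
have [r rE] := choice H.
exists r => [x y|b]; apply: (@ext_inj_injective _ _ E).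
  by rewrite raddfB -!rE !raddfB sB !opprD addrACA.
by rewrite -rE ext_projj -(subrr 0) sB subrr subr0.
Qed.

(** A morphism of extensions transports retractions backwards and sections forwards, so passing
    between the two gives both directions without inverting it. *)
Lemma ext_hom_has_retraction E F :
  ext_hom E F -> has_retraction E <-> has_retraction F.
Proof.
move=> [f [_ fj pf]]; split; last first.
  move=> [r rB rj]; exists (fun x => r (f x)) => [x y|b]; last by rewrite fj.
  by rewrite raddfB rB.
move=> /has_retraction_section[s sB sp]; apply/has_retraction_section.
exists (fun a => f (s a)) => [x y|a]; last by rewrite pf.
by rewrite sB raddfB.
Qed.

Lemma split_has_retraction : has_retraction (split_ext A B).
Proof. by exists fst. Qed.

Lemma ws_equiv_has_retraction (E F : ws_extension A B) :
  ws_equiv E F -> has_retraction E <-> has_retraction F.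
Proof.
elim=> {E F} [E F|//|E F _ -> //|E F G _ -> _ -> //].
exact: ext_hom_has_retraction.
Qed.

(** In a one-element group the class of [E] is that of the split extension, which has a
    retraction. *)
Lemma Ews_neq0 (E : ws_extension A B) :
  ~ has_retraction E -> ~ ab_isomorphic (Ews A B) trivial_group.
Proof.
move=> nE [f [/bij_inj f_inj _]]; apply: nE.
have /ws_cls_eq/ws_equiv_has_retraction -> : ws_cls E = ws_cls (ws_split A B).
  by apply: f_inj; case: (f _); case: (f _).
exact: split_has_retraction.
Qed.

(** Restrict the retraction along the canonical map from [ext_mid E] to the pushout. *)
Lemma push_retraction (B' : topologicalZmodType) (f : {additive B -> B'})
    (cf : continuous f) E :
  has_retraction (push_ext cf E) ->
  exists2 h : ext_mid E -> B', zmod_morphism h &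
    forall b, h (ext_inj E b) = f b.
Proof.
move=> [r rB rj]; exists (fun x => r (push_cls f x 0)) => [x y|b].
  by rewrite -rB -push_clsB subrr.
rewrite -[RHS]rj; congr r; apply/push_clsP; exists b.
by rewrite subr0 sub0r.
Qed.

End Splitting.

(** * The cut of Q at the irrational number 1/sqrt 2 *)

Lemma two_sqr_neq1 (x : rat) : 2 * x ^+ 2 != 1.
Proof.
apply/negP => /eqP x2.
have : 2 * numq x ^+ 2 = denq x ^+ 2.
  apply: (@intr_inj rat); rewrite rmorphM !rmorphXn /= numqE exprMn.
  by rewrite mulrA x2 mul1r.
(* The 2-adic valuation is odd on the left and even on the right. *)
move=> /(congr1 absz); rewrite abszM !abszX => /(congr1 (logn 2)).
(* [logn 2 0] is 0 by default, so the numerator must be nonzero. *)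
have x0 : (0 < `|numq x|)%N.
  by rewrite absz_gt0 numq_eq0; apply/eqP => x0; move: x2; rewrite x0; lra.
rewrite lognM ?expn_gt0 ?x0 // !lognX logn_prime //; lia.
Qed.

Section Cut.
Variable R : realFieldType.

(* The lower part of the cut at 1/sqrt 2, which need not exist in [R]. *)
Definition cut : set R^o := [set x | x < 0 \/ 2 * x ^+ 2 < 1].

Lemma cut_le x y : x <= y -> cut y -> cut x.
Proof.
move=> xy [y0|y1]; first by left; lra.
by have [x0|x0] := ltP x 0; [left|right; nra].
Qed.

Lemma cut0 : cut 0.
Proof. by right; rewrite expr0n mulr0. Qed.

Lemma cut1 : ~ cut 1.
Proof. by case; rewrite ?expr1n; lra. Qed.

Lemma sqr2_continuous : continuous (fun x : R^o => (2 * x ^+ 2 : R^o)).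
Proof.
move=> x; apply: (@cvgM _ _ (nbhs x)); first exact: cvg_cst.
exact: (@cvgM _ _ (nbhs x) _ id id x x).
Qed.

Lemma cut_open : open cut.
Proof.
apply: openU; first exact: open_lt.
apply: (open_comp (D := [set y : R^o | y < 1])); last exact: open_lt.
by move=> x _; exact: sqr2_continuous.
Qed.

(** With no boundary point in the field, strict inequalities also describe the complement. *)
Lemma cutC_open : (forall x : R, 2 * x ^+ 2 != 1) -> open (~` cut).
Proof.
move=> irr.
have -> : ~` cut = [set x : R^o | 0 < x] `&` [set x : R^o | 1 < 2 * x ^+ 2].
  apply/seteqP; split => x /=.
    move=> nx; have x1 : 1 < 2 * x ^+ 2.
      by rewrite lt_neqAle eq_sym irr leNgt; apply/negP => h; apply: nx; right.
    split => //; rewrite lt_neqAle leNgt; apply/andP; split; last first.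
      by apply/negP => h; apply: nx; left.
    by apply/eqP => x0; move: x1; rewrite -x0; lra.
  by move=> [x0 x1] [|]; lra.
apply: openI; first exact: open_gt.
apply: (open_comp (D := [set y : R^o | 1 < y])); last exact: open_gt.
by move=> x _; exact: sqr2_continuous.
Qed.

End Cut.

(** * A fundamental domain: the rationals between 1/sqrt 2 - 1 and 1/sqrt 2 *)

Definition fundom : set rat^o := [set x | cut x /\ ~ cut (x + 1)].

Lemma fundom_open : open fundom.
Proof.
apply: openI; first exact: cut_open.
apply: (open_comp (f := fun x : rat^o => x + 1) (D := ~` @cut rat)).
  move=> x _; apply: (@continuous_add_fun _ rat^o id (fun=> 1)) => z.
    exact: cvg_id.
  exact: cvg_cst.
exact: cutC_open two_sqr_neq1.
Qed.

Lemma fundom0 : fundom 0.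
Proof. by split; [exact: cut0|rewrite add0r; exact: cut1]. Qed.

Lemma fundom_int (x y : rat^o) : fundom x -> fundom y ->
  (x - y : rat) \is a Num.int -> x = y.
Proof.
wlog : x y / x <= y => [H|xy].
  have /orP[xy|xy] := le_total (x : rat) y; first exact: H.
  by move=> dx dy xyZ; apply/esym/H => //; rewrite -opprB rpredN.
(* If [x < y], the integer [x - y] is at most -1, so [x + 1 <= y] would lie below the cut. *)
move=> [_ nx] [cy _] /intrP[m xym].
apply/eqP; rewrite eq_le xy /= leNgt; apply/negP => ltxy.
apply: nx; apply: cut_le cy.
have : (m%:~R : rat) < 0 by rewrite -xym; lra.
rewrite ltrz0 => m0; have : (m%:~R : rat) <= (-1)%:~R by rewrite ler_int; lia.
rewrite -xym; lra.
Qed.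

Lemma tpi_ZP (x y : rat^o) :
  ((tpi _ x : QQmodZZ) = tpi _ y) <-> ((x - y : rat) \is a Num.int).
Proof. exact: tpiE. Qed.

Lemma fundom_tpi (a : QQmodZZ) :
  exists y : rat^o, fundom y /\ (tpi _ y : QQmodZZ) = a.
Proof.
pose x : rat := trepr a.
have hx (m : int) : (tpi _ (x - m%:~R : rat^o) : QQmodZZ) = a.
  rewrite -[RHS]treprK; apply/tpi_ZP.
  by rewrite -/x addrAC subrr sub0r rpredN; exact: intr_int.
have /andP[] := floor_itv x; rewrite rmorphD /= => x0 x1.
(* The representative in [0, 1) is kept if below the cut, and lowered by 1 otherwise. *)
have [c|c] := pselect (@cut rat (x - (Num.floor x)%:~R)).
  exists (x - (Num.floor x)%:~R); split=> //; split=> // /(cut_le _) h.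
  by apply: (@cut1 rat); apply: h; lra.
exists (x - (Num.floor x + 1)%:~R); split; last exact: hx.
rewrite rmorphD /=; split; first by left; rewrite /=; lra.
by rewrite opprD addrA subrK.
Qed.

Lemma QQmodZZ_section : exists s : QQmodZZ -> rat^o,
  [/\ continuous s, (forall a, (tpi _ (s a) : QQmodZZ) = a) & s 0 = 0].
Proof.
have [s sP] := choice fundom_tpi; exists s; split.
- apply: tquot_continuous => x.
  pose d : rat^o := s (tpi _ x) - x.
  have cd : continuous (fun y : rat^o => y + d).
    by apply: (@continuous_add_fun _ rat^o id (fun=> d)) => z;
       [exact: cvg_id|exact: cvg_cst].
  (* The section is locally a translation: for [y] near [x], [y + d] stays in the open domain and is
     congruent to [s (tpi _ y)] modulo Z, hence equal to it. *)
  have dE : \forall y \near x, y + d = s (tpi _ y).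
    have dx : nbhs (x + d) fundom.
      apply: open_nbhs_nbhs; split; first exact: fundom_open.
      by rewrite /d addrC subrK; exact: (sP _).1.
    near=> y; have yd : fundom (y + d) by near: y; exact: (cd x _ dx).
    apply: fundom_int => //; first exact: (sP _).1.
    have -> : y + d - s (tpi _ y) = (s (tpi _ x) - x) - (s (tpi _ y) - y).
      by rewrite /d opprB addrC addrCA [RHS]addrC addrA addrAC addrA.
    by rewrite rpredB //; apply/tpi_ZP; rewrite (sP _).2.
  have xd : x + d = s (tpi _ x) by rewrite /d addrC subrK.
  suff : s (tpi _ y) @[y --> x] --> x + d by rewrite xd.
  by apply: cvg_trans (cd x); exact: near_eq_cvg.
- by move=> a; exact: (sP a).2.
apply: fundom_int; [exact: (sP _).1|exact: fundom0|].
by apply/tpi_ZP; rewrite (sP _).2 raddf0.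
Unshelve. all: by end_near.
Qed.

(** * The extension of Q/Z by Z with middle group Q *)

Definition QQ_inj (m : ZZ) : rat^o := (m : int)%:~R.

Fact QQ_inj_zmod : zmod_morphism QQ_inj.
Proof. by move=> x y; rewrite /QQ_inj -rmorphB. Qed.

HB.instance Definition _ :=
  GRing.isZmodMorphism.Build ZZ rat^o QQ_inj QQ_inj_zmod.

Lemma discrete_fun_continuous (V : zmodType) (T : topologicalType)
  (f : discrete_topology V -> T) : continuous f.
Proof. by apply/continuousP => U _; exact: discrete_open. Qed.

Local Obligation Tactic := idtac.

Program Definition QQ_ext : extension QQmodZZ ZZ :=
  @Extension QQmodZZ ZZ rat^o QQ_inj (@tpi rat^o _) _ _ _ _ _ _ _.
Next Obligation. exact: discrete_fun_continuous. Qed.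
Next Obligation. by move=> x y /intr_inj. Qed.
Next Obligation.
apply: additive_embedding; first exact: discrete_fun_continuous.
(* The open unit ball contains no integer but 0. *)
move=> W /nbhs_singleton W0; exists (ball (0 : rat^o) 1).
  exact: nbhsx_ballx.
move=> m; rewrite /= -ball_normE /= sub0r normrN /QQ_inj -intr_norm.
rewrite ltrz1 => m0; suff -> : m = 0 by [].
by apply/eqP; rewrite -absz_eq0; lia.
Qed.
Next Obligation. exact: tpi_continuous. Qed.
Next Obligation. by move=> a; exists (trepr a); exact: treprK. Qed.
Next Obligation. exact: tpi_open. Qed.
Next Obligation.
apply/seteqP; split => [_ [m _ <-]|x] /=.
  by rewrite -(raddf0 (tpi _)); apply/tpi_ZP; rewrite subr0; exact: intr_int.
rewrite -(raddf0 (tpi _)) => /tpi_ZP; rewrite subr0 => /intrP[m ->].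
by exists m.
Qed.

Definition QQ_ws : ws_extension QQmodZZ ZZ :=
  WsExtension (QQmodZZ_section : weak_split QQ_ext).

Lemma zmod_morphism_QQ_divisible (V : zmodType) (h : rat^o -> V) (k : nat) :
  zmod_morphism h -> (0 < k)%N -> exists v, h 1 = v *+ k.
Proof.
move=> hB k0; exists (h (k%:R^-1 : rat)).
pose ha : {additive rat^o -> V} :=
  HB.pack h (GRing.isZmodMorphism.Build _ _ h hB).
rewrite -[RHS](raddfMn ha) /=; congr h.
by rewrite -[RHS](@mulr_natr rat) mulVf // pnatr_eq0 -lt0n.
Qed.

Lemma QQ_ext_no_retraction : ~ has_retraction QQ_ext.
Proof.
move=> [r rB rj].
have [v v1] := zmod_morphism_QQ_divisible rB (isT : (0 < 2)%N).
have : (1 : int) = (v : int) *+ 2 by exact: etrans (esym (rj (1 : int))) v1.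
lia.
Qed.

(** * The pushout of this extension to Z/n *)

Definition Zmod_pi (n : nat) (m : ZZ) : Zmod n :=
  \pi_({ideal_quot (GRing.ZmodClosed.clone int (dvdz n) _)})%qT (m : int).

Lemma Zmod_piP (n : nat) (x y : int) :
  (Zmod_pi n x = Zmod_pi n y) <-> (n %| x - y)%Z.
Proof.
rewrite -[(n %| x - y)%Z]/(x - y \in GRing.ZmodClosed.clone int (dvdz n) _).
rewrite Quotient.idealrBE.
by split=> /eqP.
Qed.

Fact Zmod_pi_zmod (n : nat) : zmod_morphism (@Zmod_pi n).
Proof. by move=> x y; rewrite /Zmod_pi Quotient.pi_add Quotient.pi_opp. Qed.

HB.instance Definition _ (n : nat) :=
  GRing.isZmodMorphism.Build ZZ (Zmod n) (@Zmod_pi n) (@Zmod_pi_zmod n).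

Lemma Zmod_pi_continuous (n : nat) : continuous (@Zmod_pi n).
Proof. exact: discrete_fun_continuous. Qed.

Definition QQ_ws_mod (n : nat) : ws_extension QQmodZZ (Zmod n) :=
  WsExtension (push_ws (@Zmod_pi_continuous n) (ws_extP QQ_ws)).

Lemma QQ_ws_mod_no_retraction (n : nat) :
  n <> 1%N -> ~ has_retraction (QQ_ws_mod n).
Proof.
move=> n1 /push_retraction[h hB hj].
(* Multiplication by [n] kills Z/n, so divisibility by [n] forces 1 to vanish there. For [n = 0] the
   quotient is Z, where 1 is not even. *)
pose k := if n == 0 then 2%N else n.
have k0 : (0 < k)%N by rewrite /k; case: (posnP n).
have [v v1] := zmod_morphism_QQ_divisible hB k0.
pose z : int := repr (v : {ideal_quot (GRing.ZmodClosed.clone int (dvdz n) _)}).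
have vz : v = Zmod_pi n z by rewrite /Zmod_pi reprK.
have : (n %| 1 - z *+ k)%Z.
  apply/Zmod_piP; rewrite -[LHS](hj (1 : int)) [LHS]v1 vz.
  exact/esym/(raddfMn (@Zmod_pi n)).
rewrite /k; case: eqVneq => [->|n0].
  rewrite dvd0z; lia.
by rewrite -mulr_natr natz rpredBr ?dvdz_mull // dvdz1 => /eqP.
Qed.

(** The value [n = 1] is set apart because Z/1 is zero, so that every extension by it splits;
    [n = 0] is allowed, with Z/0 = Z. *)
Theorem corollary5p12 (n : nat) :
  ~ ab_isomorphic (Ews QQmodZZ ZZ) trivial_group /\
  (n <> 1%N -> ~ ab_isomorphic (Ews QQmodZZ (Zmod n)) trivial_group).
Proof.
split; first exact: (Ews_neq0 (E := QQ_ws)) QQ_ext_no_retraction.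
by move=> n1; apply: Ews_neq0 (QQ_ws_mod_no_retraction n1).
Qed.
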